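(* Let $k$ be an infinite field, let $S$ be a standard $\mathbb{N}^n$-graded $k$-algebra, and let $S^\Delta$ be its diagonal subring. Suppose that $d := \dim S^\Delta \geq 1$, and that $\{x_{ij} \mid 1\leq i \leq n,\ 1\leq j \leq d\}$ and $\{w_{ij} \mid 1\leq i \leq n,\ 1\leq j \leq d\}$ are complete reductions of $S$ (of type $d$). Then there is a proper Zariski-closed subset $M \subsetneq k^{n \times d}$ such that for any $C = \{c_{ij}\} \in k^{n \times d}$, we have $C \notin M$ if and only if the $n \times d$ matrix $\{x^C_{ij}\}$ is a complete reduction of $S$, where $$x^C_{ij} := \begin{cases} x_{ij} & \text{if } j < d, \\ \sum_{h=1}^d c_{ih} w_{ih} & \text{if } j = d. \end{cases}$$
   Context: All rings are commutative with identity. For an $\mathbb{N}^n$-graded $k$-algebra $S$ and $1 \leq i \leq n$, write $S^{(i)} := S_{(0,\dotsc,0,1,0,\dotsc,0)}$, with the $1$ in the $i$th position. $S$ is called standard if $S_{(0,\dotsc,0)} = k$ and $S$ is generated as a $k$-algebra by $S^{(1)} \cup \cdots \cup S^{(n)}$. The diagonal subring of $S$ is $S^\Delta := k[S_{(1,1,\dotsc,1)}]$, the $k$-subalgebra generated by $S_{(1,\dotsc,1)}$, which is $\mathbb{N}$-graded by giving elements of $S_{(m,m,\dotsc,m)}$ degree $m$; $\dim$ denotes Krull dimension. A complete reduction of $S$ of type $r$ is an $n \times r$ matrix $\{x_{ij}\}$ with each $x_{ij} \in S^{(i)}$ such that, setting $X_j := \prod_{i=1}^n x_{ij}$ for $1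 \leq j \leq r$, the ring $S^\Delta$ is module-finite over its subring $k[X_1,\dotsc,X_r]$. A Zariski-closed subset of $k^{n\times d}$ is the common zero locus in $k^{n \times d}$ of a set of polynomials over $k$ in the $nd$ coordinates. *)

(* Defs.v *)
From HB Require Import structures.
From mathcomp Require Import all_boot all_order all_algebra.
From mathcomp Require Import boolp classical_sets cardinality.
From mathcomp Require Import mpoly.

Set Implicit Arguments.
Unset Strict Implicit.
Unset Printing Implicit Defensive.

Import GRing.Theory.
Local Open Scope ring_scope.

(* Prop-valued predicates are turned into boolean ones by `[< _ >], so that the
   closure predicates of ssralg and ring_quotient apply to them; classically
   nothing is lost, every subset of a type being of this form. *)

Section GeneratedSubalgebra.
Variables (k : fieldType) (S : comAlgType k).

Definition gen_subalg (G : set S) : {pred S} :=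
  fun x => `[< forall A : {pred S},
    subalg_closed A -> (forall g, G g -> g \in A) -> x \in A >].

Lemma gen_subalg_closed (G : set S) : subalg_closed (gen_subalg G).
Proof.
split=> [|a u v /asboolP Gu /asboolP Gv|u v /asboolP Gu /asboolP Gv];
  apply/asboolP => A /[dup] algA [A1 AZ AM] GA //.
- by apply: AZ; [exact: Gu | exact: Gv].
- by apply: AM; [exact: Gu | exact: Gv].
Qed.

HB.instance Definition _ (G : set S) :=
  GRing.isSubalgClosed.Build k S (gen_subalg G) (gen_subalg_closed G).

Definition gen_subalg_type (G : set S) : Type := {x : S | x \in gen_subalg G}.
HB.instance Definition _ (G : set S) := SubChoice.on (gen_subalg_type G).
HB.instance Definition _ (G : set S) :=
  [SubChoice_isSubComNzRing of gen_subalg_type G by <:].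

(* A is module-finite over B, for subrings B of A in S. *)
Definition module_finite (A B : {pred S}) : Prop :=
  exists (m : nat) (g : 'I_m -> S),
    (forall l, g l \in A) /\
    forall y, y \in A ->
      exists b : 'I_m -> S, (forall l, b l \in B) /\ y = \sum_l b l * g l.

End GeneratedSubalgebra.

Definition prime_ideal (R : comNzRingType) (P : {pred R}) : Prop :=
  idealr_closed P /\ prime_idealr_closed P.

(* P_0 < P_1 < ... < P_l; the values of P beyond l are irrelevant. *)
Definition prime_chain (R : comNzRingType) (l : nat) (P : nat -> {pred R}) :=
  (forall i, (i <= l)%N -> prime_ideal (P i)) /\
  (forall i, (i < l)%N ->
     {subset P i <= P i.+1} /\ ~ {subset P i.+1 <= P i}).

Definition has_krull_dim (R : comNzRingType) (d : nat) : Prop :=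
  (exists P : nat -> {pred R}, prime_chain d P) /\
  (forall l (P : nat -> {pred R}), prime_chain l P -> (l <= d)%N).

Definition multideg (n : nat) := {ffun 'I_n -> nat}.

Definition unit_deg n (i : 'I_n) : multideg n := [ffun j => nat_of_bool (j == i)].
Definition diag_deg n : multideg n := [ffun=> 1%N].

(* Sg a is the component S_a; the last two fields say that S is the internal
   direct sum of the S_a. *)
Record is_grading (k : fieldType) (S : comAlgType k) (n : nat)
    (Sg : multideg n -> set S) : Prop := IsGrading {
  grading0 : forall a, Sg a 0;
  gradingP : forall a (c : k) x y, Sg a x -> Sg a y -> Sg a (c *: x + y);
  grading1 : Sg 0 1;
  gradingM : forall a b x y, Sg a x -> Sg b y -> Sg (a + b) (x * y);
  grading_span : forall x : S, exists (s : seq (multideg n)) (f : multideg n -> S),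
    [/\ uniq s, forall a, Sg a (f a) & x = \sum_(a <- s) f a];
  grading_indep : forall (s : seq (multideg n)) (f : multideg n -> S),
    uniq s -> (forall a, Sg a (f a)) -> \sum_(a <- s) f a = 0 ->
    forall a, a \in s -> f a = 0
}.

Section StandardGraded.
Variables (k : fieldType) (S : comAlgType k) (n : nat).
Variable Sg : multideg n -> set S.

Definition standard_graded : Prop :=
  [/\ is_grading Sg,
      (forall x, Sg 0 x <-> exists c : k, x = c%:A) &
      forall x : S, x \in gen_subalg [set y | exists i, Sg (unit_deg i) y]].

Definition diagonal : {pred S} := gen_subalg (Sg (diag_deg n)).
Definition diagonal_ring : comNzRingType := gen_subalg_type (Sg (diag_deg n)).

Definition complete_reduction (r : nat) (x : 'M[S]_(n, r)) : Prop :=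
  (forall i j, Sg (unit_deg i) (x i j)) /\
  module_finite diagonal
    (gen_subalg [set X | exists j, X = \prod_(i < n) x i j]).

End StandardGraded.

(* The entries of an n x d matrix are numbered by 'I_(n * d) via mxvec. *)
Definition zariski_closed (k : fieldType) (n d : nat) (M : set 'M[k]_(n, d)) :=
  exists F : set {mpoly k[n * d]},
    forall C, M C <-> forall p, F p -> p.@[fun l => mxvec C 0 l] = 0.

(* Column indices run over 0, ..., d - 1. *)
Definition replace_last (k : fieldType) (S : comAlgType k) (n d : nat)
    (x w : 'M[S]_(n, d)) (C : 'M[k]_(n, d)) : 'M[S]_(n, d) :=
  \matrix_(i, j) if (j.+1 < d)%N then x i j else \sum_(h < d) C i h *: w i h.

(* Main.v *)
(* Let R_i be the degree i part of the diagonal subring and I the ideal generated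
   by X_1, ..., X_(d-1).  By a graded Nakayama argument, elements Z_1, ..., Z_r of
   R_1 make the diagonal subring module-finite over k[Z_1, ..., Z_r] if and only if
   R_(i+1) = sum_j Z_j R_i for all large i.  So T = X_d is eventually surjective on
   B_i = R_i / I_i, hence eventually bijective, and each y in R_1 gets a matrix
   phi(y), that of y / T on B_m for a fixed large m; these matrices commute.  The
   matrix x^C is a complete reduction if and only if det phi(Y_C) <> 0, where
   Y_C = prod_i sum_h c_ih w_ih, and this is a polynomial condition on C.
   It can be satisfied: since w is a complete reduction, the phi(prod_i w_ij)
   generate the unit ideal, and on a simple subquotient of B_m one of them is
   invertible. *)
Require Import Defs.
From mathcomp Require Import all_boot all_order all_algebra.
From mathcomp Require Import boolp classical_sets cardinality.
From mathcomp Require Import finmap mpoly.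

Set Implicit Arguments.
Unset Strict Implicit.
Unset Printing Implicit Defensive.

Import GRing.Theory.
Local Open Scope ring_scope.

(** * Commuting matrices with polynomial coefficients *)

Lemma infinite_poly_nonroot (k : fieldType) (p : {poly k}) :
  infinite_set [set: k]%classic -> p != 0 -> exists t, p.[t] != 0.
Proof.
move=> kinf p0; apply: contrapT => nop.
have rootp t : root p t.
  by apply/negPn/negP => pt; apply: nop; exists t.
have [B _ leB] := infinite_set_fset (size p) kinf.
have := max_poly_roots p0 (rs := enum_fset B) _ (fset_uniq B).
by rewrite ltnNge leB => H; apply/notF/H/allP => t _; exact: rootp.
Qed.

Section CommonNonroot.
Variables (k : fieldType) (N : nat).
Hypothesis kinf : infinite_set [set: k]%classic.

Lemma mpoly_on_line (C D : 'I_N -> k) (p : {mpoly k[N]}) :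
  exists q : {poly k}, forall t, q.[t] = p.@[fun l => C l + t * (D l - C l)].
Proof.
exists (\sum_(m <- msupp p)
   (p@_m)%:P * \prod_i ((C i)%:P + 'X * (D i - C i)%:P) ^+ m i) => t.
rewrite mevalE horner_sum; apply: eq_bigr => m _.
by rewrite !hornerE horner_prod; congr (_ * _); apply: eq_bigr => i _; rewrite !hornerE.
Qed.

(** On the line through [C] and [D], [p] is nonzero at parameter 0 and [q] at parameter 1. The
    product of the two univariate restrictions is thus nonzero, and an infinite field has a
    parameter that is not a root of it. *)
Lemma mpoly_common_nonroot (C D : 'I_N -> k) (p q : {mpoly k[N]}) :
  p.@[C] != 0 -> q.@[D] != 0 -> exists E, p.@[E] != 0 /\ q.@[E] != 0.
Proof.
move=> pC qD.
have [P HP] := mpoly_on_line C D p; have [Q HQ] := mpoly_on_line C D q.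
have P0 : P != 0.
  apply: contraNneq pC => P0; have <- : P.[0] = p.@[C]; last by rewrite P0 horner0.
  by rewrite HP; apply: meval_eq => l; rewrite mul0r addr0.
have Q0 : Q != 0.
  apply: contraNneq qD => Q0; have <- : Q.[1] = q.@[D]; last by rewrite Q0 horner0.
  by rewrite HQ; apply: meval_eq => l; rewrite mul1r subrKC.
have [t] := infinite_poly_nonroot kinf (mulf_neq0 P0 Q0).
rewrite hornerM mulf_eq0 negb_or HP HQ => /andP[Pt Qt].
by exists (fun l => C l + t * (D l - C l)).
Qed.

(** This becomes the equation of the exceptional set; [map_mx] only embeds the constant matrices
    into matrices over the polynomial ring. *)
Definition det_comb (K : finType) e (c : K -> {mpoly k[N]}) (z : K -> 'M[k]_e) :=
  \det (\sum_h c h *: map_mx (@mpolyC N k) (z h)).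

Lemma meval_det_comb (K : finType) e (c : K -> {mpoly k[N]}) (z : K -> 'M[k]_e) C :
  (det_comb c z).@[C] = \det (\sum_h (c h).@[C] *: z h).
Proof.
rewrite /det_comb -det_map_mx; congr (\det _).
apply/matrixP => i j; rewrite !mxE !summxE raddf_sum; apply: eq_bigr => h _.
by rewrite !mxE /= mevalM mevalC.
Qed.

(* Induction on e: if some z (b j) *m z (a j) is neither 0 nor invertible, its
   kernel is a common invariant subspace, so that all z are simultaneously
   block triangular. *)
Lemma det_comb_nonroot (K J : finType) (a b : J -> K) (c : K -> {mpoly k[N]}) :
  (forall j, exists C, forall h, (c h).@[C] = (h == a j)%:R) ->
  forall e (z : K -> 'M[k]_e),
  (forall h h', z h *m z h' = z h' *m z h) ->
  \sum_j z (b j) *m z (a j) = 1%:M ->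
  exists C, (det_comb c z).@[C] != 0.
Proof.
move=> iso e; have [m] := ubnP e; elim: m e => // m IH e /ltnSE le_em z zC z1.
have [e0|e_gt0] := posnP e.
  subst e; exists (fun=> 0); rewrite meval_det_comb det_mx00; exact: oner_neq0.
have [j nzj] : exists j, z (b j) *m z (a j) != 0.
  apply: contrapT => nop.
  have : \sum_j z (b j) *m z (a j) = 0.
    by apply: big1 => j _; apply/eqP/negPn/negP => nz; apply: nop; exists j.
  rewrite z1 => /matrixP/(_ (Ordinal e_gt0) (Ordinal e_gt0)).
  by rewrite !mxE eqxx => /eqP; rewrite oner_eq0.
set A := z (b j) *m z (a j) in nzj.
have AC h : A *m z h = z h *m A by rewrite /A -mulmxA (zC (a j)) mulmxA (zC (b j)) mulmxA.
have [fullA|nfullA] := boolP (row_free A).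
  (* If [A] is invertible, so is its factor [z (a j)], and a point isolating [a j] reduces the
     combination to that matrix. *)
  have [C HC] := iso j; exists C.
  rewrite meval_det_comb (bigD1 (a j)) //= HC eqxx scale1r.
  rewrite big1 ?addr0 => [|h /negPf nh]; last by rewrite HC nh scale0r.
  by move: fullA; rewrite row_free_unit /A unitmx_mul => /andP[_]; rewrite unitmxE unitfE.
set r := \rank A; pose s := (e - r)%N.
have rgt0 : (0 < r)%N by rewrite lt0n mxrank_eq0.
have rlt : (r < e)%N by rewrite ltn_neqAle rank_leq_row andbT.
have ers : e = (r + s)%N by rewrite /s subnKC // ltnW.
(* Forgetting these values allows [e] to be replaced by [r + s], as block matrices require. *)
clearbody s A.
have [L [Q [Lu Qu defA]]] : exists L Q : 'M_e,
    [/\ L \in unitmx, Q \in unitmx & A = L *m (pid_mx r *m Q)].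
  exists (col_ebase A), (row_ebase A).
  by rewrite col_ebase_unit row_ebase_unit mulmxA mulmx_ebase.
clearbody r; subst e.
pose y h := invmx L *m z h *m L.
have yM h h' : y h *m y h' = invmx L *m (z h *m z h') *m L.
  by rewrite /y !mulmxA mulmxK.
(* Matrices act on row vectors. In the coordinates given by [L], the kernel of [A] is spanned by the
   last [s] basis vectors; it is stable because [z h] commutes with [A], which kills the lower left
   block. *)
have blk0 h : dlsubmx (y h) = 0.
  pose G := Q *m L; have Gu : G \in unitmx by rewrite unitmx_mul Qu Lu.
  have PG : pid_mx r *m G = invmx L *m A *m L by rewrite defA !mulmxA mulVmx // mul1mx.
  have yPG : y h *m (pid_mx r *m G) = pid_mx r *m G *m y h.
    by rewrite PG /y !mulmxA !mulmxK // -!(mulmxA (invmx L)) AC.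
  have yP : y h *m pid_mx r = pid_mx r *m (G *m y h *m invmx G).
    by rewrite -[LHS](mulmxK Gu) -(mulmxA (y h)) yPG !mulmxA.
  move: yP; rewrite pid_mx_block -{1}(submxK (y h)) -[G *m _ *m _]submxK.
  rewrite !mulmx_block !mulmx0 !mul0mx !mulmx1 !addr0 => /(congr1 dlsubmx).
  by rewrite !block_mxKdl.
have yE h : y h = block_mx (ulsubmx (y h)) (ursubmx (y h)) 0 (drsubmx (y h)).
  by rewrite -{1}(submxK (y h)) blk0.
have yC h h' : y h *m y h' = y h' *m y h by rewrite !yM zC.
have y1 : \sum_j y (b j) *m y (a j) = 1%:M.
  by under eq_bigr do rewrite yM; rewrite -mulmx_suml -mulmx_sumr z1 mulmx1 mulVmx.
have blkM h h' : y h *m y h' =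
  block_mx (ulsubmx (y h) *m ulsubmx (y h'))
    (ulsubmx (y h) *m ursubmx (y h') + ursubmx (y h) *m drsubmx (y h')) 0
    (drsubmx (y h) *m drsubmx (y h')).
  by rewrite {1}yE {1}(yE h') mulmx_block !mulmx0 !mul0mx !addr0 !add0r.
(* Both diagonal blocks inherit commutation and the unit relation, and are smaller than [e] since
   [r] and [s] are positive. *)
have [|||C1 HC1] := IH r _ (fun h => ulsubmx (y h)).
- by apply: leq_trans le_em; rewrite -{1}(addn0 r) ltn_add2l -(ltn_add2l r) addn0.
- by move=> h h'; have := congr1 ulsubmx (yC h h'); rewrite !blkM !block_mxKul.
- have := congr1 ulsubmx y1; rewrite scalar_mx_block block_mxKul => <-.
  rewrite /ulsubmx !linear_sum; apply: eq_bigr => i _.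
  by rewrite /= blkM -!/(ulsubmx _) block_mxKul.
have [|||C2 HC2] := IH s _ (fun h => drsubmx (y h)).
- by apply: leq_trans le_em; rewrite -{1}(add0n s) ltn_add2r.
- by move=> h h'; have := congr1 drsubmx (yC h h'); rewrite !blkM !block_mxKdr.
- have := congr1 drsubmx y1; rewrite scalar_mx_block block_mxKdr => <-.
  rewrite /drsubmx !linear_sum; apply: eq_bigr => i _.
  by rewrite /= blkM -!/(drsubmx _) block_mxKdr.
(* The blocks are nonsingular at possibly different points; one point serving both makes the
   triangular matrix nonsingular. *)
have [C [HC HC']] := mpoly_common_nonroot HC1 HC2; exists C.
move: HC HC'; rewrite !meval_det_comb => HC HC'.
suff -> : \det (\sum_h (c h).@[C] *: z h) =
  \det (\sum_h (c h).@[C] *: ulsubmx (y h)) * \det (\sum_h (c h).@[C] *: drsubmx (y h)).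
  exact: mulf_neq0.
have -> : \sum_h (c h).@[C] *: z h = L *m (\sum_h (c h).@[C] *: y h) *m invmx L.
  rewrite mulmx_sumr mulmx_suml; apply: eq_bigr => h _.
  by rewrite -scalemxAr -scalemxAl /y !mulmxA mulmxV // mul1mx mulmxK.
rewrite !det_mulmx mulrC mulrA -det_mulmx mulVmx // det1 mul1r.
rewrite -[X in \det X]submxK.
have -> : dlsubmx (\sum_h (c h).@[C] *: y h) = 0.
  rewrite /dlsubmx !linear_sum big1 // => h _.
  by rewrite /= !linearZ /= [lsubmx _]blk0 scaler0.
rewrite det_ublock; congr (_ * _); congr determinant.
  by rewrite /ulsubmx !linear_sum; apply: eq_bigr => h _; rewrite /= !linearZ.
by rewrite /drsubmx !linear_sum; apply: eq_bigr => h _; rewrite /= !linearZ.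
Qed.

End CommonNonroot.

(** * Multiplication matrices *)

Section MultiplicationMatrices.
Variables (k : fieldType) (S : comAlgType k).
Variables (R I : nat -> set S) (T : S).
Hypothesis R0 : forall i, R i 0.
Hypothesis RZ : forall {i} (c : k) {y z}, R i y -> R i z -> R i (c *: y + z).
Hypothesis R1 : R 0%N 1.
Hypothesis RM : forall {i j y z}, R i y -> R j z -> R (i + j)%N (y * z).
Hypothesis I0 : forall i, I i 0.
Hypothesis IZ : forall {i} (c : k) {y z}, I i y -> I i z -> I i (c *: y + z).
Hypothesis RI : forall {i j y z}, R i y -> I j z -> I (i + j)%N (y * z).
Hypothesis RT : R 1%N T.

Definition comb e (v : 'I_e -> S) s (u : 'rV[k]_e) : S :=
  \sum_i u 0 i *: (T ^+ s * v i).

(** Together with [independent], this says that the [T ^+ s * v i] form a basis of [R_(s+m)] modulo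
    [I_(s+m)] for every [s], hence that [T] acts bijectively from degree [m] on. *)
Definition spanning m e (v : 'I_e -> S) :=
  (forall i, R m (v i)) /\
  forall s y, R (s + m)%N y -> exists u, I (s + m)%N (y - comb v s u).

Definition independent m e (v : 'I_e -> S) :=
  forall s u, I (s + m)%N (comb v s u) -> u = 0.

Hypothesis R_fd : forall i, exists e (v : 'I_e -> S), (forall l, R i (v l)) /\
  forall y, R i y -> exists a : 'I_e -> k, y = \sum_l a l *: v l.
Hypothesis RT_surj : exists N, forall i, (N <= i)%N -> forall y, R i.+1 y ->
  exists2 r, R i r & I i.+1 (y - T * r).

Lemma I_eq i y z : I i y -> y = z -> I i z. Proof. by move=> + <-. Qed.

Lemma IB i y z : I i y -> I i z -> I i (y - z).
Proof. by move=> Iy Iz; rewrite addrC -scaleN1r; apply: IZ. Qed.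

Lemma ID i y z : I i y -> I i z -> I i (y + z).
Proof. by move=> Iy Iz; rewrite -[y]scale1r; apply: IZ. Qed.

Lemma I_sum i (J : finType) (F : J -> S) : (forall j, I i (F j)) -> I i (\sum_j F j).
Proof. by move=> IF; elim/big_ind: _ => //; exact: ID. Qed.

Lemma I_scale i (c : k) y : I i y -> I i (c *: y).
Proof. by move=> Iy; rewrite -[_ *: _]addr0; apply: IZ. Qed.

Lemma I_sumZ i (J : finType) (a : J -> k) (F : J -> S) :
  (forall j, I i (F j)) -> I i (\sum_j a j *: F j).
Proof. by move=> IF; apply: I_sum => j; exact: I_scale. Qed.

Lemma R_sumZ i (J : finType) (a : J -> k) (F : J -> S) :
  (forall j, R i (F j)) -> R i (\sum_j a j *: F j).
Proof.
by move=> RF; elim/big_rec: _ => // j y _ Ry; exact: RZ.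
Qed.

Lemma RTX s : R s (T ^+ s).
Proof. by elim: s => [|s IH]; rewrite ?expr0 // exprS -add1n; exact: RM. Qed.

Lemma combZ e (v : 'I_e -> S) s (c : k) u w :
  comb v s (c *: u + w) = c *: comb v s u + comb v s w.
Proof.
rewrite /comb scaler_sumr -big_split; apply: eq_bigr => i _ /=.
by rewrite !mxE scalerDl scalerA.
Qed.

Lemma comb0 e (v : 'I_e -> S) s : comb v s 0 = 0.
Proof. by rewrite /comb big1 // => i _; rewrite mxE scale0r. Qed.

Lemma combB e (v : 'I_e -> S) s u w : comb v s (u - w) = comb v s u - comb v s w.
Proof. by rewrite addrC -scaleN1r combZ scaleN1r addrC. Qed.

Lemma comb_sumZ e (v : 'I_e -> S) s (J : finType) (a : J -> k) (w : J -> 'rV_e) :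
  comb v s (\sum_j a j *: w j) = \sum_j a j *: comb v s (w j).
Proof.
elim/big_rec2: _ => [|j _ w' _ <-]; first exact: comb0.
by rewrite combZ.
Qed.

Lemma combX e (v : 'I_e -> S) s t u : T ^+ t * comb v s u = comb v (t + s) u.
Proof.
by rewrite /comb mulr_sumr; apply: eq_bigr => i _; rewrite -scalerAr mulrA exprD.
Qed.

Lemma R_comb m e (v : 'I_e -> S) s u :
  (forall i, R m (v i)) -> R (s + m)%N (comb v s u).
Proof. by move=> Rv; apply: R_sumZ => i; exact: RM (RTX s) _. Qed.

(** Take a spanning family in a degree [N] from which [T] is surjective modulo [I]; powers of [T]
    carry it to all higher degrees. *)
Lemma exists_spanning : exists m e (v : 'I_e -> S), spanning m v.
Proof.
have [N HN] := RT_surj; have [e [v [Rv spanv]]] := R_fd N.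
exists N, e, v; split=> // s; elim: s => [|s IH] y Ry.
  have [a ->] := spanv _ Ry; exists (\row_i a i).
  rewrite /comb; under [X in _ - X]eq_bigr do rewrite mxE mul1r.
  by rewrite subrr.
have [r Rr Iyr] := HN _ (leq_addl s N) _ Ry.
have [u Iu] := IH _ Rr; exists u.
apply: I_eq (ID Iyr (RI RT Iu)) _.
by rewrite mulrBr addrA subrK (combX _ _ 1).
Qed.

(** A relation in degree [s + m] makes the vector [i0] redundant there, and its multiples by powers
    of [T] do so in all higher degrees. The base degree is raised accordingly. *)
Lemma spanning_drop m e (v : 'I_e.+1 -> S) s u i0 :
  spanning m v -> I (s + m)%N (comb v s u) -> u 0 i0 != 0 ->
  spanning (s + m) (fun i => T ^+ s * v (lift i0 i)).
Proof.
move=> [Rv spanv] Iu ui0; split=> [i|t y]; first exact: RM (RTX s) _.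
rewrite addnA => Ry; have [w Iw] := spanv _ _ Ry.
(* Subtracting a multiple of the relation cancels the coordinate at [i0]. *)
pose w' := - (w 0 i0 / u 0 i0) *: u + w.
have w'0 : w' 0 i0 = 0 by rewrite !mxE mulNr divfK // addNr.
exists (\row_i w' 0 (lift i0 i)).
have := RI (RTX t) Iu; rewrite combX addnA => /(IZ (w 0 i0 / u 0 i0))/(_ Iw) Iw'.
apply: I_eq Iw' _.
have -> : comb (fun i => T ^+ s * v (lift i0 i)) t (\row_i w' 0 (lift i0 i)) =
    comb v (t + s) w'.
  rewrite {2}/comb (bigD1_ord i0) //= w'0 scale0r add0r.
  by apply: eq_bigr => i _; rewrite mxE mulrA exprD.
by rewrite combZ scaleNr opprD opprK addrCA.
Qed.

(** A spanning family of least size, over all base degrees at once, is independent: any relation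
    would allow one vector to be dropped. *)
Lemma exists_basis : exists m e (v : 'I_e -> S), spanning m v /\ independent m v.
Proof.
pose P e := `[< exists m (v : 'I_e -> S), spanning m v >].
have exP : exists e, P e.
  by have [m [e [v Hv]]] := exists_spanning; exists e; apply/asboolP; exists m, v.
case: (ex_minnP exP) => e /asboolP[m [v Hv]] emin; exists m, e, v; split=> // s u Iu.
apply/rowP => i; rewrite [RHS]mxE; apply: contrapT => /eqP ui.
case: e v Hv emin u Iu i ui => [|e] v Hv emin u Iu i ui; first by case: i ui.
suff: (e < e)%N by rewrite ltnn.
apply: emin; apply/asboolP; exists (s + m)%N.
by eexists; exact: spanning_drop Hv Iu ui.
Qed.

(* A is the matrix of multiplication by y : B_m -> B_(s+m), where B_i = R_i / I_i,
   in the bases v and T^s v; equivalently, of y / T^s on B_m. *)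
Definition mult_mx m e (v : 'I_e -> S) s y (A : 'M[k]_e) :=
  forall u, I (s + m)%N (y * comb v 0 u - comb v s (u *m A)).

Section Basis.
Variables (m e : nat) (v : 'I_e -> S).
Hypotheses (spanv : spanning m v) (indv : independent m v).

Lemma mult_mx_ex s y : R s y -> exists A, mult_mx m v s y A.
Proof.
move=> Ry; have [Rv sp] := spanv.
have /choice[f Hf] i : exists u, I (s + m)%N (y * v i - comb v s u).
  by apply: sp; exact: RM.
exists (\matrix_i f i) => u.
apply: I_eq (I_sumZ (fun i => u 0 i) Hf) _.
rewrite mulmx_sum_row comb_sumZ mulr_sumr -sumrB; apply: eq_bigr => i _.
by rewrite rowK scalerBr -scalerAr mul1r.
Qed.

Lemma mult_mx_uniq s y A B : mult_mx m v s y A -> mult_mx m v s y B -> A = B.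
Proof.
move=> HA HB; apply/row_matrixP => i; apply/eqP; rewrite -subr_eq0; apply/eqP.
apply: (indv (s := s)); rewrite !rowE.
apply: I_eq (IB (HB (delta_mx 0 i)) (HA (delta_mx 0 i))) _.
by rewrite combB opprB addrC addrA subrK.
Qed.

Lemma mult_mxZ s (c : k) y z A B : mult_mx m v s y A -> mult_mx m v s z B ->
  mult_mx m v s (c *: y + z) (c *: A + B).
Proof.
move=> HA HB u; apply: I_eq (IZ c (HA u) (HB u)) _.
by rewrite mulmxDr -scalemxAr combZ mulrDl -scalerAl scalerBr addrACA -opprD.
Qed.

(** Multiply the congruence for [y] by [z] and the one for [z] by [T ^+ s], then add. Division by
    powers of [T] is what turns maps between different degrees into composable endomorphisms. *)
Lemma mult_mxM s t y z A B : R t z -> mult_mx m v s y A -> mult_mx m v t z B ->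
  mult_mx m v (s + t) (y * z) (A *m B).
Proof.
move=> Rz HA HB u; rewrite addnAC.
have := RI (RTX s) (HB (u *m A)); rewrite addnA [(s + t + m)%N]addnAC => I2.
have := RI Rz (HA u); rewrite [(t + _)%N]addnC => I1.
apply: I_eq (ID I1 I2) _.
rewrite !mulrBr mulmxA combX; rewrite [T ^+ s * _]mulrCA combX addn0 addrA subrK.
by rewrite mulrA [z * y]mulrC.
Qed.

Lemma mult_mxT s : mult_mx m v s (T ^+ s) 1%:M.
Proof. by move=> u; rewrite mulmx1 combX addn0 subrr. Qed.

Lemma mult_mx_sumZ s (J : finType) (a : J -> k) (y : J -> S) (A : J -> 'M[k]_e) :
  (forall j, mult_mx m v s (y j) (A j)) ->
  mult_mx m v s (\sum_j a j *: y j) (\sum_j a j *: A j).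
Proof.
move=> HA; elim/big_rec2: _ => [|j A' y' _ IH]; last exact: mult_mxZ.
by move=> u; rewrite mul0r mulmx0 comb0 subrr.
Qed.

(** Both products are the matrix of [y * z], which is unique. *)
Lemma mult_mx_comm s t y z A B : R s y -> R t z ->
  mult_mx m v s y A -> mult_mx m v t z B -> A *m B = B *m A.
Proof.
move=> Ry Rz HA HB; apply: (mult_mx_uniq (s := s + t) (y := y * z)).
  exact: mult_mxM.
by rewrite addnC mulrC; exact: mult_mxM.
Qed.

(** In the bases [T ^+ s * v], multiplication by [y] has the same matrix [A] in every degree from
    [m] on. Hence surjectivity in a single large degree already forces invertibility, which gives
    surjectivity in all of them. *)
Lemma unit_mult_mx y A : R 1%N y -> mult_mx m v 1 y A ->
  A \in unitmx <-> exists N, forall i, (N <= i)%N -> forall z, R i.+1 z ->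
    exists2 r, R i r & I i.+1 (z - y * r).
Proof.
move=> Ry HA; have [Rv sp] := spanv; split=> [Au|[N HN]].
  exists m => i /subnK <-; move: (i - m)%N => s z Rz.
  have [u Iu] := sp s.+1 _ Rz.
  exists (comb v s (u *m invmx A)); first exact: R_comb.
  have := RI (RTX s) (HA (u *m invmx A)); rewrite addnA addn1 mulmxKV // => Iu'.
  apply: I_eq (IB Iu Iu') _.
  by rewrite mulrBr combX addn1 mulrCA combX addn0 opprB addrA subrK.
have surj (u : 'rV_e) : exists w, w *m A = u.
  (* The degree [N + m] is at least [N], where [y] is surjective, and at least [m], where [v]
     provides coordinates. *)
  have NsN : (N <= N + m)%N by exact: leq_addr.
  have [r Rr Ir] := HN _ NsN _ (R_comb N.+1 u Rv).
  have [w Iw] := sp _ _ Rr; exists w; apply/eqP; rewrite -subr_eq0; apply/eqP.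
  apply: (indv (s := N.+1)).
  have := RI (RTX N) (HA w); rewrite addnA addn1 => I1.
  have I2 : I (N.+1 + m)%N (y * (r - comb v N w)) by exact: RI Ry Iw.
  apply: I_eq (IB (I0 _) (ID I1 (ID Ir I2))) _.
  rewrite combB !mulrBr combX addn1 [T ^+ N * _]mulrCA combX addn0.
  by rewrite sub0r [X in - (_ + X)]addrA subrK [X in - X]addrC addrA subrK opprB.
have /choice[f Hf] := surj.
have : (\matrix_i f (delta_mx 0 i)) *m A = 1%:M.
  by apply/row_matrixP => i; rewrite row_mul rowK Hf rowE mulmx1.
by case/mulmx1_unit.
Qed.

End Basis.

(** The polynomial is the determinant of the multiplication matrix of the generic combination of the
    [W h]. It is not identically zero on points because the matrices of the [W (iota j)] generate
    the unit ideal. *)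
Lemma generating_locus N (H J : finType) (W : H -> S) (iota : J -> H)
    (c : H -> {mpoly k[N]}) :
  infinite_set [set: k]%classic -> (forall h, R 1%N (W h)) ->
  (exists M, forall i, (M <= i)%N -> forall y, R i.+1 y ->
     exists u : J -> S, (forall j, R i (u j)) /\ y = \sum_j W (iota j) * u j) ->
  (forall j, exists C, forall h, (c h).@[C] = (h == iota j)%:R) ->
  exists p : {mpoly k[N]}, (exists C, p.@[C] != 0) /\
    forall C, p.@[C] != 0 <-> exists M, forall i, (M <= i)%N ->
      forall y, R i.+1 y ->
        exists2 r, R i r & I i.+1 (y - (\sum_h (c h).@[C] *: W h) * r).
Proof.
move=> kinf RW [M HM] iso; have [m [e [v [spanv indv]]]] := exists_basis.
have /choice[A HA] h := mult_mx_ex spanv (RW h).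
(* A power of [T] has the identity as its matrix, so expressing one through the [W (iota j)] yields
   the unit relation between matrices. *)
have [u [Ru TE]] := HM M (leqnn M) _ (RTX M.+1).
have /choice[B HB] j := mult_mx_ex spanv (Ru j).
exists (det_comb c A); split; last first.
  move=> C; have HC := mult_mx_sumZ (fun h => (c h).@[C]) HA.
  rewrite meval_det_comb -unitfE -unitmxE.
  by apply: unit_mult_mx HC => //; exact: R_sumZ.
have sum1 : \sum_j B j *m A (iota j) = 1%:M.
  apply: (mult_mx_uniq indv _ (mult_mxT m v M.+1)).
  rewrite TE; have HBA j : mult_mx m v M.+1 (W (iota j) * u j) (B j *m A (iota j)).
    by rewrite -addn1 mulrC; apply: mult_mxM.
  have := mult_mx_sumZ (fun=> 1) HBA.
  by rewrite -!scaler_sumr !scale1r.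
(* The cofactors [u j] must belong to the commuting family; their coefficient 0 leaves the
   determinant unchanged. *)
pose z (q : H + J) := match q with inl h => A h | inr j => B j end.
pose c' (q : H + J) := match q with inl h => c h | inr j => 0 end.
have zC q q' : z q *m z q' = z q' *m z q.
  have Hz p : exists s y, R s y /\ mult_mx m v s y (z p).
    by case: p => p; [exists 1%N, (W p) | exists M, (u p)].
  have [s [y [Ry Hy]]] := Hz q; have [t [y' [Ry' Hy']]] := Hz q'.
  exact: (mult_mx_comm indv Ry Ry' Hy Hy').
have [|C HC] := det_comb_nonroot kinf (a := inl \o iota) (b := inr) (c := c') _ zC sum1.
  move=> j; have [C HC] := iso j; exists C; case=> [h|j'] /=; first by rewrite HC.
  by rewrite meval0.
exists C; move: HC; rewrite !meval_det_comb big_sumType /=.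
rewrite [X in _ + X]big1 ?addr0 // => j _.
by rewrite meval0 scale0r.
Qed.

End MultiplicationMatrices.

(** * Module-finiteness of the diagonal subring *)

Lemma sum_enum_val (V : nmodType) (J : finType) (F : J -> V) :
  \sum_l F l = \sum_(i < #|J|) F (enum_val i).
Proof. by rewrite -(big_enum_val (A := J)); apply: eq_bigl => l. Qed.

Section DiagonalGrading.
Variables (k : fieldType) (S : comAlgType k) (n' : nat).
Notation n := n'.+1.
Variable Sg : multideg n -> set S.
Hypothesis gr : is_grading Sg.

(** * Homogeneous components in the diagonal subring *)

Definition cst_deg i : multideg n := [ffun=> i].

Definition diag_part i : set S := [set y | y \in Defs.diagonal Sg /\ Sg (cst_deg i) y].

Lemma diag_part0 i : diag_part i 0.
Proof. by split; [exact: rpred0 | exact: grading0]. Qed.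

Lemma diag_partP i (c : k) y z :
  diag_part i y -> diag_part i z -> diag_part i (c *: y + z).
Proof.
move=> [Dy Sy] [Dz Sz]; split; last exact: gradingP.
by apply: rpredD => //; exact: rpredZ.
Qed.

Lemma diag_part1 : diag_part 0 1.
Proof.
split; first exact: rpred1.
by rewrite (_ : cst_deg 0 = 0); [exact: grading1 gr | apply/ffunP => i; rewrite !ffunE].
Qed.

Lemma diag_partM i j y z :
  diag_part i y -> diag_part j z -> diag_part (i + j) (y * z).
Proof.
move=> [Dy Sy] [Dz Sz]; split; first exact: rpredM.
rewrite (_ : cst_deg (i + j) = cst_deg i + cst_deg j); first exact: (gradingM gr).
by apply/ffunP => l; rewrite !ffunE.
Qed.

(** A decomposition is a function on all degrees, zero from some [D] on, so that decompositions can
    be added and compared without matching lengths. *)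
Definition components (r : S) (f : nat -> S) :=
  (forall t, diag_part t (f t)) /\
  exists D, (forall t, (D <= t)%N -> f t = 0) /\ r = \sum_(t < D) f t.

Lemma sum_components D E (f : nat -> S) : (forall t, (D <= t)%N -> f t = 0) ->
  (D <= E)%N -> \sum_(t < D) f t = \sum_(t < E) f t.
Proof.
move=> fD leDE; rewrite (big_ord_widen _ f leDE) [RHS](bigID (fun t : 'I_E => t < D)%N) /=.
by rewrite [X in _ + X]big1 ?addr0 // => t; rewrite -leqNgt; exact: fD.
Qed.

Lemma componentsP (c : k) r r' f f' : components r f -> components r' f' ->
  components (c *: r + r') (fun t => c *: f t + f' t).
Proof.
move=> [Df [D [f0 ->]]] [Df' [D' [f'0 ->]]]; split; first by move=> t; exact: diag_partP.
exists (maxn D D'); split.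
  by move=> t; rewrite geq_max => /andP[Dt D't]; rewrite f0 // f'0 // scaler0 addr0.
rewrite (sum_components f0 (leq_maxl D D')) (sum_components f'0 (leq_maxr D D')).
by rewrite scaler_sumr -big_split.
Qed.

Lemma components0 : components 0 (fun=> 0).
Proof.
split; first by move=> t; exact: diag_part0.
by exists 0%N; split=> //; rewrite big_ord0.
Qed.

Lemma components_sumZ (J : finType) (a : J -> k) (r : J -> S) (f : J -> nat -> S) :
  (forall j, components (r j) (f j)) ->
  components (\sum_j a j *: r j) (fun t => \sum_j a j *: f j t).
Proof.
move=> rf; elim: (index_enum J) => [|j s IH].
  rewrite big_nil (_ : (fun t => _) = fun=> 0); first exact: components0.
  by apply/funext => t; rewrite big_nil.
rewrite big_cons (_ : (fun t => _) =
  fun t => a j *: f j t + \sum_(j <- s) a j *: f j t); first exact: componentsP.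
by apply/funext => t; rewrite big_cons.
Qed.

Lemma components_sum (J : finType) (r : J -> S) (f : J -> nat -> S) :
  (forall j, components (r j) (f j)) ->
  components (\sum_j r j) (fun t => \sum_j f j t).
Proof.
move=> /(components_sumZ (fun=> 1)).
under eq_bigr do rewrite scale1r.
by congr components; apply/funext => t; apply: eq_bigr => j _; rewrite scale1r.
Qed.

(** The effect on components of a factor of degree 1: degree 0 receives nothing. *)
Definition shift (f : nat -> S) t := if t is t'.+1 then f t' else 0.

Lemma componentsM Z r f : diag_part 1 Z -> components r f ->
  components (Z * r) (fun t => Z * shift f t).
Proof.
move=> DZ [Df [D [f0 ->]]]; split.
  case=> [|t] /=; first by rewrite mulr0; exact: diag_part0.
  by rewrite -add1n; exact: diag_partM.
exists D.+1; split; first by case=> //= t leDt; rewrite f0 // mulr0.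
by rewrite big_ord_recl /= mulr0 add0r mulr_sumr.
Qed.

Lemma components_homog i y : diag_part i y ->
  components y (fun t => if t == i then y else 0).
Proof.
move=> Dy; split; first by move=> t; case: eqP => [->//|_]; exact: diag_part0.
exists i.+1; split; first by move=> t; case: eqP => // ->; rewrite ltnn.
rewrite (bigD1 ord_max) //= eqxx big1 ?addr0 // => t /negPf; by rewrite -val_eqE /= => ->.
Qed.

Lemma components0_eq f : components 0 f -> forall t, f t = 0.
Proof.
move=> [Df [D [f0 sum0]]] t; have [/f0//|ltD] := leqP D t.
(* [grading_indep] needs a family on all multidegrees: [F] reads the degree off one coordinate and
   vanishes off the constant multidegrees. *)
pose F (a : multideg n) := if a == cst_deg (a ord0) then f (a ord0) else 0.
(* A coordinate [ord0] exists because [n] is positive; with no coordinates all constant multidegrees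
   would coincide. *)
have cst_inj : injective cst_deg by move=> i j /ffunP/(_ ord0); rewrite !ffunE.
have FE i : F (cst_deg i) = f i by rewrite /F ffunE eqxx.
rewrite -FE; apply: (grading_indep gr (s := [seq cst_deg i | i <- iota 0 D])).
- by rewrite map_inj_uniq ?iota_uniq.
- by move=> a; rewrite /F; case: eqP => [{1}->|_]; [case: (Df (a ord0)) | exact: grading0].
- rewrite big_map [RHS]sum0 (_ : iota 0 D = index_iota 0 D) ?big_mkord; last first.
    by rewrite /index_iota subn0.
  by apply: eq_bigr => i _; rewrite FE.
- by apply: map_f; rewrite mem_iota add0n.
Qed.

Lemma components_uniq r f g : components r f -> components r g -> f =1 g.
Proof.
move=> rf rg t; apply/eqP; rewrite -subr_eq0 addrC; apply/eqP.
have r0 : -1 *: r + r = 0 by rewrite scaleN1r addNr.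
have := componentsP (-1) rg rf; rewrite r0 => /components0_eq/(_ t).
by rewrite scaleN1r.
Qed.

(** The elements of the diagonal subring with such a decomposition form a subalgebra containing its
    generators, which are homogeneous of degree 1. *)
Lemma components_ex r : r \in Defs.diagonal Sg -> exists f, components r f.
Proof.
move=> Dr; suff [] : r \in Defs.diagonal Sg /\ exists f, components r f by [].
pose P : {pred S} := fun r => `[< r \in Defs.diagonal Sg /\ exists f, components r f >].
apply/asboolP; move: Dr => /asboolP/(_ P); apply.
- split=> [|a y z /asboolP[Dy [f Hf]] /asboolP[Dz [g Hg]]|
            y z /asboolP[Dy [f Hf]] /asboolP[Dz [g Hg]]]; apply/asboolP.
  + by split; [exact: rpred1 | eexists; exact: components_homog diag_part1].
  + split; first by apply: rpredD => //; exact: rpredZ.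
    by eexists; exact: componentsP Hf Hg.
  + split; first exact: rpredM.
    have [Df [D [_ ->]]] := Hf; have [Dg [D' [_ ->]]] := Hg.
    rewrite mulr_suml.
    under eq_bigr do rewrite mulr_sumr.
    have /choice[h Hh] (i : 'I_D) : exists h, components (\sum_(j < D') f i * g j) h.
      eexists; apply: components_sum => j.
      exact: components_homog (diag_partM (Df i) (Dg j)).
    by eexists; exact: components_sum Hh.
- move=> y Sy; have Dy : y \in Defs.diagonal Sg by apply/asboolP => A _; exact.
  by apply/asboolP; split=> //; eexists; apply: (@components_homog 1).
Qed.

(** * Module-finiteness in terms of homogeneous parts *)

Definition family_algebra r (Z : 'I_r -> S) : {pred S} :=
  gen_subalg [set X | exists j, X = Z j].

(** For [Z] of degree 1: the quotient of the diagonal subring by the ideal of the [Z j] vanishes in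
    all large degrees. *)
Definition eventually_generate r (Z : 'I_r -> S) :=
  exists N, forall i, (N <= i)%N -> forall y, diag_part i.+1 y ->
    exists u : 'I_r -> S, (forall j, diag_part i (u j)) /\ y = \sum_j Z j * u j.

Definition finite_diag_parts := forall i, exists e (v : 'I_e -> S),
  (forall l, diag_part i (v l)) /\
  forall y, diag_part i y -> exists a : 'I_e -> k, y = \sum_l a l *: v l.

Lemma family_algebraP r (Z : 'I_r -> S) b : (forall j, diag_part 1 (Z j)) ->
  b \in family_algebra Z ->
  exists (c : k) (u : 'I_r -> S),
    (forall j, u j \in Defs.diagonal Sg) /\ b = c%:A + \sum_j Z j * u j.
Proof.
move=> DZ /asboolP H.
pose P : {pred S} := fun b => `[< exists (c : k) (u : 'I_r -> S),
  (forall j, u j \in Defs.diagonal Sg) /\ b = c%:A + \sum_j Z j * u j >].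
apply/asboolP; apply: (H P).
- split=> [|a y z /asboolP[c [u [Du ->]]] /asboolP[c' [u' [Du' ->]]]|
            y z /asboolP[c [u [Du ->]]] /asboolP[c' [u' [Du' ->]]]]; apply/asboolP.
  + exists 1, (fun=> 0); split=> [j|]; first exact: rpred0.
    by rewrite scale1r big1 ?addr0 // => j _; rewrite mulr0.
  + exists (a * c + c'), (fun j => a *: u j + u' j); split=> [j|].
      by apply: rpredD => //; exact: rpredZ.
    rewrite scalerDr scalerDl scalerA addrACA; congr (_ + _).
    rewrite scaler_sumr -big_split; apply: eq_bigr => j _ /=.
    by rewrite mulrDr scalerAr.
  + exists (c * c'), (fun j => c' *: u j + (c%:A + \sum_j Z j * u j) * u' j).
    have DZu : \sum_j Z j * u j \in Defs.diagonal Sg.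
      by apply: rpred_sum => j _; apply: rpredM => //; case: (DZ j).
    split=> [j|].
      apply: rpredD; first exact: rpredZ.
      by apply: rpredM => //; apply: rpredD => //; apply: rpredZ; exact: rpred1.
    under [in RHS]eq_bigr do rewrite mulrDr -scalerAr mulrCA.
    rewrite big_split /= -mulr_sumr -scaler_sumr mulrDr [RHS]addrA; congr (_ + _).
    by rewrite mulr_algr scalerDr scalerA [c' * c]mulrC.
- move=> _ [j ->]; apply/asboolP; exists 0, (fun l => (l == j)%:R); split=> [l|].
    by case: eqP => _; [exact: rpred1 | exact: rpred0].
  rewrite scale0r add0r (bigD1 j) //= eqxx mulr1 big1 ?addr0 // => l /negPf ->.
  by rewrite mulr0.
Qed.

(** Write each coefficient over [family_algebra Z] as a constant plus an element of the ideal of the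
    [Z j], then take the part of degree [i]. The first sum vanishes in large degrees, giving
    eventual generation; in every degree the formula gives finite dimension by induction. *)
Lemma finite_homog_decomp r (Z : 'I_r -> S) : (forall j, diag_part 1 (Z j)) ->
  module_finite (Defs.diagonal Sg) (family_algebra Z) ->
  exists m (g : 'I_m -> nat -> S), [/\ forall l t, diag_part t (g l t),
    exists D, forall l t, (D <= t)%N -> g l t = 0 &
    forall i y, diag_part i y -> exists (b : 'I_m -> k) (f : 'I_r -> nat -> S),
      (forall j t, diag_part t (f j t)) /\
      y = \sum_l b l *: g l i + \sum_j Z j * shift (f j) i].
Proof.
move=> DZ [m [g [Dg spang]]].
have /choice[G HG] l := components_ex (Dg l).
exists m, G; split=> [l|| i y Dy]; first by case: (HG l).
  have /choice[D HD] l : exists D, forall t, (D <= t)%N -> G l t = 0.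
    by case: (HG l) => _ [D [D0 _]]; exists D.
  exists (\max_l D l)%N => l t leDt; apply: HD; apply: leq_trans leDt.
  exact: leq_bigmax.
have [b [Zb yE]] := spang y Dy.1.
have /choice[c Hc] l := family_algebraP DZ (Zb l).
have /choice[u Hu] := Hc.
pose w j := \sum_l u l j * g l.
have /choice[F HF] j : exists f, components (w j) f.
  apply: components_ex; apply: rpred_sum => l _; apply: rpredM => //.
  by case: (Hu l).
exists c, F; split=> [j|]; first by case: (HF j).
(* The factor 1 matches the shape expected by [componentsP]. *)
have yE' : y = 1 *: (\sum_l c l *: g l) + \sum_j Z j * w j.
  rewrite yE scale1r /w; under [X in _ + X]eq_bigr do rewrite mulr_sumr.
  rewrite exchange_big -big_split; apply: eq_bigr => l _ /=.
  have [_ ->] := Hu l; rewrite mulrDl mulr_algl mulr_suml; congr (_ + _).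
  by apply: eq_bigr => j _; rewrite mulrA.
have C1 := components_sumZ c HG.
have C2 := components_sum (fun j => componentsM (DZ j) (HF j)).
have := componentsP 1 C1 C2; rewrite -yE' => /(components_uniq (components_homog Dy))/(_ i).
by rewrite eqxx scale1r.
Qed.

Lemma finite_eventually_generate r (Z : 'I_r -> S) : (forall j, diag_part 1 (Z j)) ->
  module_finite (Defs.diagonal Sg) (family_algebra Z) -> eventually_generate Z.
Proof.
move=> DZ /(finite_homog_decomp DZ)[m [g [Dg [D g0] span]]].
exists D => i leDi y /span[b [f [Df ->]]].
exists (fun j => f j i); split=> //.
by rewrite big1 ?add0r // => l _; rewrite g0 ?scaler0 // leqW.
Qed.

(** Degree [i.+1] is spanned by the components of the module generators and by the products of the
    [Z j] with a spanning family of degree [i]. *)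
Lemma finite_parts r (Z : 'I_r -> S) : (forall j, diag_part 1 (Z j)) ->
  module_finite (Defs.diagonal Sg) (family_algebra Z) -> finite_diag_parts.
Proof.
move=> DZ /(finite_homog_decomp DZ)[m [g [Dg _ span]]].
suff H i : exists (J : finType) (v : J -> S), (forall l, diag_part i (v l)) /\
    forall y, diag_part i y -> exists a : J -> k, y = \sum_l a l *: v l.
  move=> i; have [J [v [Dv Hv]]] := H i.
  exists #|J|, (fun l => v (enum_val l)); split=> // y /Hv[a ->].
  by exists (fun l => a (enum_val l)); rewrite [LHS]sum_enum_val.
elim: i => [|i [J [v [Dv Hv]]]].
  exists ('I_m : finType), (fun l => g l 0%N); split=> // y /span[b [f [_ ->]]].
  by exists b; rewrite [X in _ + X]big1 ?addr0 // => j _; rewrite mulr0.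
exists ('I_m + 'I_r * J)%type.
exists (fun q => match q with inl l => g l i.+1 | inr p => Z p.1 * v p.2 end).
split=> [[l|[j l]]|y /span[b [f [Df ->]]]] //=; first by rewrite -add1n; exact: diag_partM.
have /choice[a Ha] j := Hv _ (Df j i).
exists (fun q => match q with inl l => b l | inr p => a p.1 p.2 end).
rewrite big_sumType /=; congr (_ + _).
rewrite -(pair_big xpredT xpredT (fun j l => a j l *: (Z j * v l))) /=.
by apply: eq_bigr => j _; rewrite Ha mulr_sumr; apply: eq_bigr => l _; rewrite scalerAr.
Qed.

(* Graded Nakayama: bases of the first few homogeneous parts generate. *)
Lemma eventually_generate_finite r (Z : 'I_r -> S) : (forall j, diag_part 1 (Z j)) ->
  finite_diag_parts -> eventually_generate Z ->
  module_finite (Defs.diagonal Sg) (family_algebra Z).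
Proof.
move=> DZ fd [N HN].
have [J [v [Dv Hv]]] : exists (J : finType) (v : J -> S),
    (forall l, v l \in Defs.diagonal Sg) /\ forall i, (i <= N)%N ->
    forall y, diag_part i y -> exists a : J -> k, y = \sum_l a l *: v l.
  elim: (N) => [|M [J [v [Dv Hv]]]].
    have [e [v [Dv Hv]]] := fd 0%N; exists ('I_e : finType), v.
    by split=> [l|i]; [case: (Dv l) | rewrite leqn0 => /eqP ->].
  have [e [w [Dw Hw]]] := fd M.+1.
  exists (J + 'I_e)%type, (fun q => match q with inl l => v l | inr l => w l end).
  split=> [[l|l]|i]; [exact: Dv | by case: (Dw l) |].
  rewrite leq_eqVlt => /predU1P[-> y /Hw|/ltnSE leiM y /(Hv _ leiM)] [a ->].
    exists (fun q => match q with inl l => 0 | inr l => a l end).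
    by rewrite big_sumType /= [X in X + _]big1 ?add0r // => l _; rewrite scale0r.
  exists (fun q => match q with inl l => a l | inr l => 0 end).
  by rewrite big_sumType /= [X in _ + X]big1 ?addr0 // => l _; rewrite scale0r.
pose comb y := exists b : J -> S,
  (forall l, b l \in family_algebra Z) /\ y = \sum_l b l * v l.
have combD y z : comb y -> comb z -> comb (y + z).
  move=> [b [Zb ->]] [c [Zc ->]]; exists (fun l => b l + c l); split=> [l|].
    exact: rpredD.
  by rewrite -big_split; apply: eq_bigr => l _; rewrite mulrDl.
have comb_sum (I : finType) (F : I -> S) : (forall l, comb (F l)) -> comb (\sum_l F l).
  move=> cF; elim/big_ind: _ => //; exists (fun=> 0); split=> [l|]; first exact: rpred0.
  by rewrite big1 // => l _; rewrite mul0r.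
have combZ j y : comb y -> comb (Z j * y).
  move=> [b [Zb ->]]; exists (fun l => Z j * b l); split=> [l|].
    by apply: rpredM => //; apply/asboolP => A _; apply; exists j.
  by rewrite mulr_sumr; apply: eq_bigr => l _; rewrite mulrA.
have comb_homog i y : diag_part i y -> comb y.
  elim: i y => [|i IH] y Dy.
    have [a ->] := Hv _ (leq0n N) _ Dy.
    exists (fun l => (a l)%:A); split=> [l|]; first by apply: rpredZ; exact: rpred1.
    by apply: eq_bigr => l _; rewrite mulr_algl.
  (* Eventual generation descends from degree [i.+1] to [i] once [N <= i]; otherwise [i.+1 <= N] and
     [v] spans directly. *)
  have [leNi|ltiN] := leqP N i.
    have [u [Du ->]] := HN _ leNi _ Dy.
    by apply: comb_sum => j; apply: combZ; exact: IH.
  have [a ->] := Hv _ ltiN _ Dy.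
  exists (fun l => (a l)%:A); split=> [l|]; first by apply: rpredZ; exact: rpred1.
  by apply: eq_bigr => l _; rewrite mulr_algl.
exists #|J|, (fun l => v (enum_val l)); split=> // y Dy.
have [f [Df [D [_ ->]]]] := components_ex Dy.
have [b [Zb ->]] : comb (\sum_(t < D) f t) by apply: comb_sum => t; exact: comb_homog.
by exists (fun l => b (enum_val l)); split=> //; rewrite [LHS]sum_enum_val.
Qed.

End DiagonalGrading.

(** * The locus of complete reductions *)

Section Columns.
Variables (k : fieldType) (S : comAlgType k) (n : nat).
Variable Sg : multideg n.+1 -> set S.
Hypothesis gr : is_grading Sg.

Lemma graded_sumZ a (J : finType) (c : J -> k) (F : J -> S) :
  (forall j, Sg a (F j)) -> Sg a (\sum_j c j *: F j).
Proof.
move=> SF; elim/big_rec: _ => [|j y _ Sy]; [exact: grading0 | exact: gradingP].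
Qed.

(** The unit multidegrees add up to the diagonal one, so the product is a generator of the diagonal
    subring. *)
Lemma graded_prod (F : 'I_n.+1 -> S) :
  (forall i, Sg (unit_deg i) (F i)) -> diag_part Sg 1 (\prod_i F i).
Proof.
move=> SF; suff Sp : Sg (diag_deg n.+1) (\prod_i F i).
  by split=> //; apply/asboolP => A _; exact.
have -> : diag_deg n.+1 = \sum_(i < n.+1) unit_deg i.
  apply/ffunP => j; rewrite sum_ffunE ffunE (bigD1 j) //= ffunE eqxx big1 // => i.
  by rewrite ffunE eq_sym => /negPf ->.
elim/big_rec2: _ => [|i y a _ IH]; [exact: grading1 | exact: gradingM].
Qed.

End Columns.

(** Distributivity over choice functions [f]: the coefficients are monomials in the entries of [C],
    the source of the polynomial condition. *)
Lemma prod_comb (k : fieldType) (S : comAlgType k) (n d : nat)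
    (w : 'M[S]_(n, d)) (C : 'M[k]_(n, d)) :
  \prod_i \sum_h C i h *: w i h =
  \sum_(f : {ffun 'I_n -> 'I_d}) (\prod_i C i (f i)) *: \prod_i w i (f i).
Proof. by rewrite bigA_distr_bigA; apply: eq_bigr => f _; rewrite scaler_prod. Qed.

Lemma zariski_closed_empty (k : fieldType) n d :
  zariski_closed (set0 : set 'M[k]_(n, d)).
Proof.
exists [set 1%R]%classic => C; split=> // /(_ _ erefl) /eqP.
by rewrite meval1 oner_eq0.
Qed.

(** With no gradings the only multidegree is 0, so the diagonal subring is [k] and is spanned by
    1. *)
Lemma complete_reduction0 (k : fieldType) (S : comAlgType k)
    (Sg : multideg 0 -> set S) r (x : 'M[S]_(0, r)) :
  standard_graded Sg -> complete_reduction Sg x.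
Proof.
move=> [gr S0 _]; split; first by case.
exists 1%N, (fun=> 1); split=> [_|y /asboolP Dy]; first exact: rpred1.
suff [c yE] : exists c : k, y = c%:A.
  exists (fun=> c%:A); rewrite big_ord1 mulr1; split=> // _.
  by apply: rpredZ; exact: rpred1.
pose P : {pred S} := fun y => `[< exists c : k, y = c%:A >].
apply/asboolP; apply: (Dy P).
- split=> [|a u v /asboolP[b ->] /asboolP[c ->]|
            u v /asboolP[b ->] /asboolP[c ->]]; apply/asboolP.
  + by exists 1; rewrite scale1r.
  + by exists (a * b + c); rewrite scalerDl scalerA.
  + by exists (b * c); rewrite mulr_algl scalerA.
- move=> g Sg1; apply/asboolP/S0.
  by rewrite (_ : 0 = diag_deg 0) //; apply/ffunP; case.
Qed.

Theorem theorem5p1 (k : fieldType) (S : comAlgType k) (n d : nat)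
    (Sg : multideg n -> set S) (x w : 'M[S]_(n, d)) :
  infinite_set [set: k]%classic ->
  standard_graded Sg ->
  has_krull_dim (diagonal_ring Sg) d ->
  (1 <= d)%N ->
  complete_reduction Sg x ->
  complete_reduction Sg w ->
  exists M : set 'M[k]_(n, d),
    [/\ zariski_closed M,
        M <> [set: 'M[k]_(n, d)]%classic &
        forall C : 'M[k]_(n, d),
          ~ M C <-> complete_reduction Sg (replace_last x w C)].
Proof.
move=> kinf std _; case: n Sg x w std => [|n] Sg x w std.
  move=> _ _ _; exists set0; split; first exact: zariski_closed_empty.
    by move=> /seteqP[_ /(_ 0 I)].
  by move=> C; split=> [_|_ []]; exact: complete_reduction0.
case: d x w => // d x w _ [Sx finX] [Sw finW]; have [gr _ _] := std.
pose X j := \prod_i x i j; pose W (f : {ffun 'I_n.+1 -> 'I_d.+1}) := \prod_i w i (f i).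
have DX j : diag_part Sg 1 (X j) by exact: graded_prod.
have DW f : diag_part Sg 1 (W f) by exact: graded_prod.
(* Constant choice functions recover the column products of [w]. *)
pose iota (j : 'I_d.+1) : {ffun 'I_n.+1 -> 'I_d.+1} := [ffun=> j].
have WiotaE : (fun j => \prod_i w i j) = (fun j => W (iota j)).
  by apply/funext => j; apply: eq_bigr => i _; rewrite ffunE.
have fd : finite_diag_parts Sg by exact: (finite_parts gr DX).
have genX : eventually_generate Sg X by exact: finite_eventually_generate.
have genW : eventually_generate Sg (fun j => W (iota j)).
  rewrite -WiotaE; apply: finite_eventually_generate => // j.
  by apply: graded_prod.
(* The ideal of all [X j] but the last, in degree [i]. There are [d.+1] columns here, and generators
   of degree 1 contribute nothing in degree 0. *)
pose Q i : set S := if i is i'.+1 then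
  [set y : S | exists u : 'I_d -> S, (forall j, diag_part Sg i' (u j)) /\
    y = \sum_j X (widen_ord (leqnSn d) j) * u j]%classic else [set 0]%classic.
have I0 i : Q i 0.
  case: i => [//|i]; exists (fun=> 0); split=> [j|]; first exact: diag_part0.
  by rewrite big1 // => j _; rewrite mulr0.
have IZ i (c : k) y z : Q i y -> Q i z -> Q i (c *: y + z).
  case: i => [-> -> //=|i [u [Du ->]] [u' [Du' ->]]]; first by rewrite scaler0 addr0.
  exists (fun j => c *: u j + u' j); split=> [j|]; first exact: diag_partP.
  rewrite scaler_sumr -big_split; apply: eq_bigr => j _ /=.
  by rewrite mulrDr scalerAr.
have RI i j y z : diag_part Sg i y -> Q j z -> Q (i + j)%N (y * z).
  move=> Dy; case: j => [->|j [u [Du ->]]]; first by rewrite mulr0.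
  rewrite addnS; exists (fun l => y * u l); split=> [l|]; first exact: diag_partM.
  by rewrite mulr_sumr; apply: eq_bigr => l _; rewrite mulrCA.
pose last_gen y := exists N, forall i, (N <= i)%N -> forall z, diag_part Sg i.+1 z ->
  exists2 r, diag_part Sg i r & Q i.+1 (z - y * r).
(* For a family differing from [X] only in its last member, eventual generation depends on that
   member alone, modulo [Q]. *)
have last_genP y (Z : 'I_d.+1 -> S) :
    (forall j, Z (widen_ord (leqnSn d) j) = X (widen_ord (leqnSn d) j)) ->
    Z ord_max = y ->
    eventually_generate Sg Z <-> last_gen y.
  move=> ZX Zy; split=> -[N HN]; exists N => i leNi z Dz.
    have [u [Du ->]] := HN i leNi z Dz; exists (u ord_max) => //.
    exists (fun j => u (widen_ord (leqnSn d) j)); split=> //.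
    rewrite big_ord_recr /= Zy addrK; by apply: eq_bigr => j _; rewrite ZX.
  have [r Dr [u [Du zE]]] := HN i leNi z Dz.
  exists (fun j => if unlift ord_max j is Some j' then u j' else r); split=> [j|].
    by case: unliftP => [j' _|_].
  rewrite big_ord_recr /= unlift_none Zy -[LHS](subrK (y * r)) zE; congr (_ + _).
  apply: eq_bigr => j _; rewrite ZX.
  rewrite (_ : widen_ord _ j = lift ord_max j) ?liftK //.
  by apply: val_inj; rewrite /= /bump leqNgt ltn_ord.
pose c (f : {ffun 'I_n.+1 -> 'I_d.+1}) : {mpoly k[n.+1 * d.+1]} :=
  \prod_i 'X_(mxvec_index i (f i)).
have cE f C : (c f).@[C] = \prod_i C (mxvec_index i (f i)).
  by rewrite rmorph_prod; apply: eq_bigr => i _; rewrite /= mevalXU.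
(* The point is the matrix with ones in column [j] and zeros elsewhere: only the constant choice [j]
   avoids a zero factor. *)
have iso j : exists C, forall f, (c f).@[C] = (f == iota j)%:R.
  exists (fun l => mxvec (\matrix_(i < n.+1, h < d.+1) (h == j)%:R) 0 l) => f.
  rewrite cE; have [->|/eqP nf] := eqVneq.
    by rewrite big1 // => i _; rewrite mxvecE mxE ffunE eqxx.
  have /existsP[i fi] : [exists i, f i != j].
    apply: contra_notT nf; rewrite negb_exists => /forallP nf.
    by apply/ffunP => i; rewrite ffunE; apply/eqP/negPn.
  by rewrite (bigD1 i) //= mxvecE mxE (negPf fi) mul0r.
have genT : last_gen (X ord_max) by apply/(last_genP _ X).
have [p [[C0 pC0] Hp]] := @generating_locus k S (diag_part Sg) Q (X ord_max)
  (diag_part0 gr) (@diag_partP _ _ _ Sg gr) (diag_part1 gr)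
  (@diag_partM _ _ _ Sg gr) I0 IZ RI (DX _) fd genT
  _ _ _ W iota c kinf DW genW iso.
exists [set C | p.@[fun l => mxvec C 0 l] = 0]%classic; split.
- by exists [set p]%classic => C; split=> [pC _ -> //|]; exact.
- move=> /seteqP[_ /(_ (vec_mx (\row_l C0 l)) I)] /=.
  apply/eqP; rewrite (meval_eq (v2 := C0)) // => l.
  by rewrite vec_mxK mxE.
move=> C; pose Z j := \prod_i replace_last x w C i j.
have Srep i j : Sg (unit_deg i) (replace_last x w C i j).
  by rewrite mxE; case: ifP => // _; exact: graded_sumZ.
have DZ j : diag_part Sg 1 (Z j) by exact: graded_prod.
have ZX j : Z (widen_ord (leqnSn d) j) = X (widen_ord (leqnSn d) j).
  by apply: eq_bigr => i _; rewrite mxE /= ltnS ltn_ord.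
(* The last column product of the modified matrix is the combination of the [W f] whose coefficients
   are the values of [c f] at [C], the form required by [Hp]. *)
have Zmax : Z ord_max = \sum_f (c f).@[fun l => mxvec C 0 l] *: W f.
  rewrite /Z; under eq_bigr do rewrite mxE /= ltnn.
  rewrite prod_comb; apply: eq_bigr => f _; congr (_ *: _).
  by rewrite cE; apply: eq_bigr => i _; rewrite mxvecE.
have Hc : p.@[fun l => mxvec C 0 l] != 0 <-> eventually_generate Sg Z.
  by rewrite Hp; apply: iff_sym; exact: last_genP.
split=> [/eqP/Hc genZ|[_ finZ]].
  by split=> //; exact: eventually_generate_finite.
by apply/eqP/Hc; exact: finite_eventually_generate.
Qed.
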